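(* Let $\beta\colon\Gamma\times G\to T$ be a duality and let $S$ be a Heisenberg module over $\beta$. Regard $S$ as a module over the group algebra $KG$ by restricting the action of $H(\beta)$ to $G$. Then the free Heisenberg algebra on the Heisenberg module $S$ is the symmetric algebra $S\hookrightarrow\mathrm{Sym}_{KG}(S)$ (nonunital, i.e. its part $\bigoplus_{k\ge1}\mathrm{Sym}^k_{KG}(S)$ of positive degree), with Heisenberg action given by $$(x,\xi)\bullet s_1\cdots s_k=x\;(s_1^{\xi})\cdots(s_k^{\xi})\qquad(s_1,\dots,s_k\in S,\ (x,\xi)\in G\times\Gamma),$$ where $s^\xi:=\xi\bullet s$ and $x$ acts as an element of the scalar ring $KG$. That is, this is a well-defined Heisenberg algebra over $\beta$, and every Heisenberg morphism $\phi\colon S\to U$ of Heisenberg modules into (the underlying Heisenberg module of) a Heisenberg algebra $U$ over $\beta$ extends uniquely to a morphism of Heisenberg algebras $\mathrm{Sym}_{KG}(S)\to U$.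
   Context: All algebras are associative and commutative but not necessarily unital. $G,\Gamma$ are additive abelian groups, $T$ a multiplicative abelian group. A duality is a bilinear map $\beta\colon\Gamma\times G\to T$, $(\xi,x)\mapsto\langle\xi|x\rangle$, such that $\xi\mapsto\langle\xi|\cdot\rangle$ and $x\mapsto\langle\cdot|x\rangle$ are injective. The Heisenberg group $H(\beta)$ consists of all $c\,(x,\xi)$ with $c\in T,x\in G,\xi\in\Gamma$, with product $c(x,\xi)\cdot c'(x',\xi')=cc'\langle\xi|x'\rangle(x+x',\xi+\xi')$; $T,G,\Gamma$ are identified with the subgroups of elements $c(0,0)$, $1(x,0)$, $1(0,\xi)$, and $(x,\xi)$ abbreviates $1(x,\xi)$. $K$ is a commutative unital ring with a fixed group homomorphism $\epsilon_T\colon T\to K^*$. A Heisenberg module over $\beta$ is a $K$-module $S$ with a $K$-linear left action $\bullet$ of $H(\beta)$ such that $c\bullet s=\epsilon_T(c)s$ for $c\in T$. A Heisenberg algebra over $\beta$ is a Heisenberg module which is also a $K$-algebra such that, for all $s,s'$, $x\bullet(ss')=(x\bullet s)s'$ for $x\in G$ and $\xi\bullet(ss')=(\xi\bullet s)(\xi\bullet s')$ for $\xi\in\Gamma$. Morphisms are $H(\beta)$-equivariant $K$-linear maps, respectively $K$-algebra homomorphisms. *)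

(* Defs.v *)
From HB Require Import structures.
From mathcomp Require Import all_boot all_order all_algebra.
From mathcomp Require Import finmap monalg boolp.

Set Implicit Arguments.
Unset Strict Implicit.
Unset Printing Implicit Defensive.

Import GRing.Theory.
Local Open Scope ring_scope.
Local Open Scope quotient_scope.

(* Commutative rings are comPzRingType, so the zero ring is allowed. The
   free modules below re-use the carrier {malg R[X]} of finitely supported functions
   but not its library module structure, which needs a nonzero ring. *)

Definition freeMod (R : pzRingType) (X : choiceType) : Type := {malg R[X]}.
HB.instance Definition _ (R : pzRingType) (X : choiceType) :=
  GRing.Zmodule.on (freeMod R X).

Section FreeModule.
Variables (R : pzRingType) (X : choiceType).
Implicit Types (f g : freeMod R X) (a b : R) (x : X).

Definition fscale a f : freeMod R X :=
  \sum_(x <- msupp f) (<< a * f@_x *g x >> : {malg R[X]}).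

Lemma fscaleE a f x : (fscale a f)@_x = a * f@_x.
Proof.
rewrite {2}[f](monalgE (f : {malg R[X]})) /fscale !raddf_sum mulr_sumr.
by apply/eq_bigr=> /= i _; rewrite !mcoeffU mulrnAr.
Qed.

Fact fscaleA a b f : fscale a (fscale b f) = fscale (a * b) f.
Proof. by apply/malgP=> x; rewrite !fscaleE mulrA. Qed.

Fact fscale1 : left_id 1 fscale.
Proof. by move=> f; apply/malgP=> x; rewrite fscaleE mul1r. Qed.

Fact fscaleDr : right_distributive fscale +%R.
Proof. by move=> a f g; apply/malgP=> x; rewrite !(mcoeffD, fscaleE) mulrDr. Qed.

Fact fscaleDl f : {morph fscale^~ f : a b / a + b}.
Proof. by move=> a b; apply/malgP=> x; rewrite !(mcoeffD, fscaleE) mulrDl. Qed.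

HB.instance Definition _ := GRing.Zmodule_isLmodule.Build R (freeMod R X)
  fscaleA fscale1 fscaleDr fscaleDl.

Definition fbase x : freeMod R X := (<< 1 *g x >> : {malg R[X]}).

Lemma fbaseZ a x : a *: fbase x = (<< a *g x >> : {malg R[X]}).
Proof.
by apply/malgP=> y; rewrite fscaleE !mcoeffU mulrnAr mulr1.
Qed.

Lemma freeMod_ind (P : freeMod R X -> Prop) :
    (forall x, P (fbase x)) -> P 0 ->
    (forall a f g, P f -> P g -> P (a *: f + g)) ->
  forall f, P f.
Proof.
move=> Pb P0 PD f; rewrite (monalgE (f : {malg R[X]})).
elim: (enum_fset _) => [|x s IHs]; rewrite (big_nil, big_cons) //.
by rewrite -fbaseZ; apply: PD.
Qed.

(* The linear extension of a map on the basis. *)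
Definition lext (V : lmodType R) (h : X -> V) f : V :=
  \sum_(x <- msupp f) f@_x *: h x.

Section Lext.
Variables (V : lmodType R) (h : X -> V).

Lemma lextEw (d : {fset X}) f : (msupp f `<=` d)%fset ->
  lext h f = \sum_(x <- d) f@_x *: h x.
Proof.
move=> le; rewrite /lext; apply: big_fset_incl => // x _ xf.
by rewrite mcoeff_outdom // scale0r.
Qed.

Fact lext_is_linear : linear (lext h).
Proof.
move=> a f g.
pose d := (msupp (a *: f + g : freeMod R X) `|` (msupp f `|` msupp g))%fset.
rewrite (@lextEw d) ?fsubsetUl // (@lextEw d f); last first.
  by apply: (fsubset_trans (fsubsetUl _ (msupp g))); apply: fsubsetUr.
rewrite (@lextEw d g); last first.
  by apply: (fsubset_trans (fsubsetUr (msupp f) _)); apply: fsubsetUr.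
rewrite scaler_sumr -big_split; apply: eq_bigr => x _ /=.
by rewrite mcoeffD fscaleE scalerDl scalerA.
Qed.

HB.instance Definition _ :=
  GRing.isLinear.Build R (freeMod R X) V *:%R (lext h) lext_is_linear.

Lemma lext_base x : lext h (fbase x) = h x.
Proof.
by rewrite (@lextEw [fset x]%fset) ?msuppU_le // big_seq_fset1 mcoeffUU scale1r.
Qed.

End Lext.

End FreeModule.

Section Convolution.
Variables (R : comPzRingType) (X : choiceType) (op : X -> X -> X).
Implicit Types (f g h : freeMod R X).

Definition conv f g : freeMod R X :=
  lext (fun x => lext (fun y => fbase R (op x y)) g) f.

Lemma conv_linl g : linear (conv^~ g).
Proof. by move=> a f h; rewrite /conv linearP. Qed.

Lemma conv_linr f : linear (conv f).
Proof.
have convE k : conv f k =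
  \sum_(x <- msupp f) f@_x *: lext (fun y => fbase R (op x y)) k by [].
move=> a g h; rewrite !convE scaler_sumr -big_split.
by apply: eq_bigr => x _ /=; rewrite linearP scalerDr !scalerA mulrC.
Qed.

Lemma conv0l g : conv 0 g = 0.
Proof. by rewrite /conv linear0. Qed.

Lemma conv0r f : conv f 0 = 0.
Proof. by have := conv_linr f (-1) 0 0; rewrite scaler0 addr0 scaleN1r addNr. Qed.

Lemma convDl f1 f2 g : conv (f1 + f2) g = conv f1 g + conv f2 g.
Proof. by rewrite /conv linearD. Qed.

Lemma convBl f1 f2 g : conv (f1 - f2) g = conv f1 g - conv f2 g.
Proof. by rewrite /conv linearB. Qed.

Lemma convZl a f g : conv (a *: f) g = a *: conv f g.
Proof. by rewrite /conv linearZ. Qed.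

Lemma convDr f g1 g2 : conv f (g1 + g2) = conv f g1 + conv f g2.
Proof. by have := conv_linr f 1 g1 g2; rewrite !scale1r. Qed.

Lemma convZr a f g : conv f (a *: g) = a *: conv f g.
Proof. by have := conv_linr f a g 0; rewrite conv0r !addr0. Qed.

Lemma conv_base x y : conv (fbase R x) (fbase R y) = fbase R (op x y).
Proof. by rewrite /conv !lext_base. Qed.

Lemma convC : commutative op -> commutative conv.
Proof.
move=> opC f g; elim/freeMod_ind: f => [x||a f1 f2 IH1 IH2].
- elim/freeMod_ind: g => [y||b g1 g2 IH1 IH2].
  + by rewrite !conv_base opC.
  + by rewrite conv0l conv0r.
  + by rewrite conv_linr conv_linl IH1 IH2.
- by rewrite conv0l conv0r.
- by rewrite conv_linl conv_linr IH1 IH2.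
Qed.

Lemma convA : associative op -> associative conv.
Proof.
move=> opA f g h; elim/freeMod_ind: f => [x||a f1 f2 IH1 IH2].
- elim/freeMod_ind: g => [y||b g1 g2 IH1 IH2].
  + elim/freeMod_ind: h => [z||c h1 h2 IH1 IH2].
    * by rewrite !conv_base opA.
    * by rewrite !conv0r.
    * by rewrite !conv_linr IH1 IH2.
  + by rewrite conv0r !conv0l conv0r.
  + by rewrite conv_linl !conv_linr conv_linl IH1 IH2.
- by rewrite !conv0l.
- by rewrite !conv_linl IH1 IH2.
Qed.

End Convolution.

Definition groupAlg (K : comPzRingType) (G : zmodType) : Type := freeMod K G.
HB.instance Definition _ (K : comPzRingType) (G : zmodType) :=
  GRing.Lmodule.on (groupAlg K G).

Section GroupAlgebra.
Variables (K : comPzRingType) (G : zmodType).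
Implicit Types (f g : groupAlg K G) (x y : G).

Definition gmul f g : groupAlg K G := conv +%R f g.

Definition gelt x : groupAlg K G := fbase K x.

Fact gmul1 : left_id (gelt 0) gmul.
Proof.
rewrite /gmul /gelt => f; elim/freeMod_ind: f => [x||a f g IHf IHg].
- by rewrite conv_base add0r.
- exact: conv0r.
- by rewrite conv_linr IHf IHg.
Qed.

Fact gmulDl : left_distributive gmul +%R.
Proof.
by move=> f g h; exact: convDl.
Qed.

HB.instance Definition _ := GRing.Zmodule_isComPzRing.Build (groupAlg K G)
  (convA (@addrA G)) (convC (@addrC G)) gmul1 gmulDl.

Definition gconst (a : K) : groupAlg K G := a *: gelt 0.

Fact gconst_is_zmod_morphism : zmod_morphism gconst.
Proof. by move=> a b; rewrite /gconst scalerBl. Qed.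

Fact gconst_is_monoid_morphism : monoid_morphism gconst.
Proof.
split=> [|a b]; first by rewrite /gconst scale1r.
rewrite /gconst -[RHS]/(conv +%R (a *: fbase K 0) (b *: fbase K 0)).
by rewrite convZl convZr conv_base addr0 scalerA.
Qed.

HB.instance Definition _ :=
  GRing.isZmodMorphism.Build K (groupAlg K G) gconst gconst_is_zmod_morphism.
HB.instance Definition _ :=
  GRing.isMonoidMorphism.Build K (groupAlg K G) gconst
    gconst_is_monoid_morphism.

End GroupAlgebra.

HB.mixin Record Lmodule_isNuComAlg (R : pzRingType) A of GRing.Lmodule R A := {
  nmul : A -> A -> A;
  nmulA : associative nmul;
  nmulC : commutative nmul;
  nmul_linl : forall b, linear (nmul^~ b)
}.
#[short(type="nuComAlgType")]
HB.structure Definition NuComAlg (R : pzRingType) :=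
  {A of GRing.Lmodule R A & Lmodule_isNuComAlg R A}.

Notation "a ∗ b" := (nmul a b) (at level 40, left associativity) : ring_scope.

Definition restr (K R : pzRingType) (f : {rmorphism K -> R}) (A : Type) : Type :=
  A.

Section RestrictionOfScalars.
Variables (K R : pzRingType) (f : {rmorphism K -> R}).

HB.instance Definition _ (A : zmodType) := GRing.Zmodule.on (restr f A).

Section Module.
Variable A : lmodType R.
Implicit Types v w : restr f A.

Definition rscale (a : K) v : restr f A := f a *: (v : A).

Fact rscaleA a b v : rscale a (rscale b v) = rscale (a * b) v.
Proof. by rewrite /rscale scalerA rmorphM. Qed.

Fact rscale1 : left_id 1 rscale.
Proof. by move=> v; rewrite /rscale rmorph1 scale1r. Qed.

Fact rscaleDr : right_distributive rscale +%R.
Proof. by move=> a v w; rewrite /rscale scalerDr. Qed.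

Fact rscaleDl v : {morph rscale^~ v : a b / a + b}.
Proof. by move=> a b; rewrite /rscale rmorphD scalerDl. Qed.

HB.instance Definition _ := GRing.Zmodule_isLmodule.Build K (restr f A)
  rscaleA rscale1 rscaleDr rscaleDl.
End Module.

Section Algebra.
Variable A : nuComAlgType R.

Fact rmul_linl (b : restr f A) : linear ((@nmul R A)^~ b : restr f A -> restr f A).
Proof. by move=> a v w; exact: nmul_linl. Qed.

HB.instance Definition _ := Lmodule_isNuComAlg.Build K (restr f A)
  (@nmulA R A) (@nmulC R A) rmul_linl.
End Algebra.

End RestrictionOfScalars.

Inductive linspan (R : pzRingType) (V : lmodType R) (B : V -> Prop) : V -> Prop :=
| linspan_gen v of B v : linspan B v
| linspan0 : linspan B 0
| linspanP a v w of linspan B v & linspan B w : linspan B (a *: v + w).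

Section SymmetricAlgebra.
Variables (R : comPzRingType) (M : lmodType R).

(* The free module on nonempty words; (s, u) stands for the word s :: u. *)
Definition word : choiceType := (M * seq M)%type.
Local Notation words := (freeMod R word).

Definition wcat (u v : word) : word := (u.1, u.2 ++ v.1 :: v.2).

(* The word s_1 ⊗ ... ⊗ s_k; the empty word is not a generator, sent to 0. *)
Definition tens (w : seq M) : words :=
  if w is s :: u then fbase R ((s, u) : word) else 0.

(* The first two families present the tensor powers M^{⊗k}, k >= 1, and the
   third one generates the commutator ideal. *)
Inductive sym_rel : words -> Prop :=
| sym_relD u s t v : sym_rel
    (tens (u ++ (s + t) :: v) - (tens (u ++ s :: v) + tens (u ++ t :: v)))
| sym_relZ u a s v : sym_rel
    (tens (u ++ (a *: s) :: v) - a *: tens (u ++ s :: v))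
| sym_relC u s t v : sym_rel
    (tens (u ++ s :: t :: v) - tens (u ++ t :: s :: v)).

Definition sym_ideal : {pred words} := fun w => `[< linspan sym_rel w >].

Lemma sym_idealP w : reflect (linspan sym_rel w) (w \in sym_ideal).
Proof. exact: asboolP. Qed.

Lemma sym_idealZD a v w :
  v \in sym_ideal -> w \in sym_ideal -> a *: v + w \in sym_ideal.
Proof. by move=> /sym_idealP v0 /sym_idealP w0; apply/sym_idealP/linspanP. Qed.

Fact sym_ideal_zmod_closed : zmod_closed sym_ideal.
Proof.
split=> [|v w v0 w0]; first by apply/sym_idealP/linspan0.
by rewrite addrC -scaleN1r sym_idealZD.
Qed.

HB.instance Definition _ :=
  GRing.isZmodClosed.Build words sym_ideal sym_ideal_zmod_closed.

Lemma sym_idealZ a v : v \in sym_ideal -> a *: v \in sym_ideal.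
Proof. by move=> v0; rewrite -[_ *: _]addr0 sym_idealZD // rpred0. Qed.

(* The positive-degree part of Sym_R(M), i.e. the sum over k >= 1 of the
   symmetric powers of M. *)
Definition Sym : Type := {ideal_quot sym_ideal}.
HB.instance Definition _ := GRing.Zmodule.on Sym.

Definition sym_pi (w : words) : Sym := \pi_({ideal_quot sym_ideal}) w.

Lemma sym_piP v w : reflect (sym_pi v = sym_pi w) (v - w \in sym_ideal).
Proof. by rewrite Quotient.idealrBE; apply: eqP. Qed.

Fact sym_pi_is_zmod_morphism : zmod_morphism sym_pi.
Proof. exact: (@raddfB _ _ (\pi_({ideal_quot sym_ideal}))). Qed.
HB.instance Definition _ :=
  GRing.isZmodMorphism.Build words Sym sym_pi sym_pi_is_zmod_morphism.

Definition sym_repr (x : Sym) : words := repr (x : {ideal_quot sym_ideal}).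

Lemma sym_reprK : cancel sym_repr sym_pi.
Proof. exact: (@reprK _ {ideal_quot sym_ideal}). Qed.

Lemma sym_elim (P : Sym -> Prop) : (forall w, P (sym_pi w)) -> forall x, P x.
Proof. by move=> Ppi x; rewrite -[x]sym_reprK. Qed.

Definition sym_scale a (x : Sym) : Sym := sym_pi (a *: sym_repr x).
Definition sym_mul (x y : Sym) : Sym :=
  sym_pi (conv wcat (sym_repr x) (sym_repr y)).

Lemma sym_pi_scale a w : sym_scale a (sym_pi w) = sym_pi (a *: w).
Proof.
by apply/sym_piP; rewrite -scalerBr; apply/sym_idealZ/sym_piP/sym_reprK.
Qed.

Fact sym_scaleA a b x : sym_scale a (sym_scale b x) = sym_scale (a * b) x.
Proof. by elim/sym_elim: x => w; rewrite !sym_pi_scale scalerA. Qed.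

Fact sym_scale1 : left_id 1 sym_scale.
Proof. by elim/sym_elim=> w; rewrite sym_pi_scale scale1r. Qed.

Fact sym_scaleDr : right_distributive sym_scale +%R.
Proof.
move=> a x y; elim/sym_elim: x => v; elim/sym_elim: y => w.
by rewrite -raddfD !sym_pi_scale scalerDr raddfD.
Qed.

Fact sym_scaleDl x : {morph sym_scale^~ x : a b / a + b}.
Proof.
by elim/sym_elim: x => w a b; rewrite !sym_pi_scale scalerDl raddfD.
Qed.

HB.instance Definition _ := GRing.Zmodule_isLmodule.Build R Sym
  sym_scaleA sym_scale1 sym_scaleDr sym_scaleDl.

Fact sym_pi_is_scalable : scalable sym_pi.
Proof. by move=> a w; rewrite -sym_pi_scale. Qed.
HB.instance Definition _ :=
  GRing.isScalable.Build R words Sym *:%R sym_pi sym_pi_is_scalable.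

Lemma wcatA : associative wcat.
Proof. by move=> [? ?] [? ?] [? ?]; rewrite /wcat /= -catA. Qed.

Lemma conv_tensl w s t u v :
  conv wcat (tens (w ++ s :: u)) (fbase R (t, v)) = tens (w ++ s :: u ++ t :: v).
Proof. by case: w => [|r w] /=; rewrite conv_base /wcat //= -catA. Qed.

Lemma sym_idealMl v w : v \in sym_ideal -> conv wcat v w \in sym_ideal.
Proof.
move=> /sym_idealP v0; elim/freeMod_ind: w => [[t w]||a w1 w2 IH1 IH2].
- elim: {v} v0 => [v rv||a v1 v2 _ IH1 _ IH2].
  + apply/sym_idealP/linspan_gen.
    case: rv => [u s r x|u a s x|u s r x].
    * rewrite (convBl wcat) (convDl wcat) !conv_tensl; exact: sym_relD.
    * rewrite (convBl wcat) (convZl wcat) !conv_tensl; exact: sym_relZ.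
    * rewrite (convBl wcat) !conv_tensl; exact: sym_relC.
  + by rewrite conv0l rpred0.
  + by rewrite (convDl wcat) (convZl wcat); apply: sym_idealZD.
- by rewrite conv0r rpred0.
- by rewrite (convDr wcat v) (convZr wcat); apply: sym_idealZD.
Qed.

Lemma tens_shift p u s q :
  tens (p ++ u ++ s :: q) - tens (p ++ s :: u ++ q) \in sym_ideal.
Proof.
elim: u p => [|t u IHu] p /=; first by rewrite subrr rpred0.
rewrite -(subrKA (tens (p ++ t :: s :: u ++ q))) rpredD //.
  by have := IHu (rcons p t); rewrite !cat_rcons.
by apply/sym_idealP/linspan_gen; apply: sym_relC.
Qed.

Lemma tens_catC p u v :
  tens (p ++ u ++ v) - tens (p ++ v ++ u) \in sym_ideal.
Proof.
elim: v p => [|s v IHv] p /=; first by rewrite cats0 subrr rpred0.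
rewrite -(subrKA (tens (p ++ s :: u ++ v))) rpredD ?tens_shift //.
by have := IHv (rcons p s); rewrite !cat_rcons.
Qed.

Lemma conv_wcatC v w : conv wcat v w - conv wcat w v \in sym_ideal.
Proof.
elim/freeMod_ind: v => [[s u]||a v1 v2 IH1 IH2]; last first.
- rewrite (convDl wcat) (convDr wcat) (convZl wcat) (convZr wcat) opprD addrACA -scalerBr.
  by apply: sym_idealZD IH1 IH2.
- by rewrite conv0l conv0r subrr rpred0.
elim/freeMod_ind: w => [[t w]||b w1 w2 IH1 IH2]; last first.
- rewrite (convDl wcat) (convDr wcat) (convZl wcat) (convZr wcat) opprD addrACA -scalerBr.
  by apply: sym_idealZD IH1 IH2.
- by rewrite conv0l conv0r subrr rpred0.
by rewrite !conv_base; apply: (tens_catC [::] (s :: u) (t :: w)).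
Qed.

Lemma sym_pi_mulC v w : sym_pi (conv wcat v w) = sym_pi (conv wcat w v).
Proof. exact/sym_piP/conv_wcatC. Qed.

Lemma sym_pi_mul v w : sym_mul (sym_pi v) (sym_pi w) = sym_pi (conv wcat v w).
Proof.
have mulE v1 v2 u : sym_pi v1 = sym_pi v2 ->
    sym_pi (conv wcat v1 u) = sym_pi (conv wcat v2 u).
  move=> /sym_piP v12; apply/sym_piP;
  by rewrite -(convBl wcat) sym_idealMl.
apply: etrans (mulE _ _ _ (sym_reprK (sym_pi v))) _.
apply: etrans (sym_pi_mulC _ _) _.
apply: etrans (mulE _ _ _ (sym_reprK (sym_pi w))) _.
exact: sym_pi_mulC.
Qed.

Fact sym_mulA : associative sym_mul.
Proof.
move=> x y z; elim/sym_elim: x => u; elim/sym_elim: y => v.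
by elim/sym_elim: z => w; rewrite !sym_pi_mul (convA wcatA).
Qed.

Fact sym_mulC : commutative sym_mul.
Proof.
move=> x y; elim/sym_elim: x => v; elim/sym_elim: y => w.
rewrite !sym_pi_mul; exact: sym_pi_mulC.
Qed.

Fact sym_mul_linl y : linear (sym_mul^~ y).
Proof.
move=> a x z; elim/sym_elim: x => u; elim/sym_elim: y => v.
by elim/sym_elim: z => w; rewrite -linearP !sym_pi_mul (convDl wcat) (convZl wcat) linearP.
Qed.

HB.instance Definition _ :=
  Lmodule_isNuComAlg.Build R Sym sym_mulA sym_mulC sym_mul_linl.

Definition sym_in (s : M) : Sym := sym_pi (tens [:: s]).

(* sym_prod s [:: s_2; ...; s_k] is the element s s_2 ... s_k of Sym^k. *)
Definition sym_prod (s : M) (u : seq M) : Sym :=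
  foldl (fun p t => p ∗ sym_in t) (sym_in s) u.

End SymmetricAlgebra.

HB.mixin Record Group_isAbelian T of Group T := {
  cmulgC : forall c d : T, (c * d = d * c)%g
}.
#[short(type="abGroupType")]
HB.structure Definition AbGroup := {T of Group T & Group_isAbelian T}.

Record duality (Γ G : zmodType) (T : abGroupType) := Duality {
  dual_fun :> Γ -> G -> T;
  dualDl : forall ξ η x, dual_fun (ξ + η) x = (dual_fun ξ x * dual_fun η x)%g;
  dualDr : forall ξ x y, dual_fun ξ (x + y) = (dual_fun ξ x * dual_fun ξ y)%g;
  dual_injl : forall ξ η, (forall x, dual_fun ξ x = dual_fun η x) -> ξ = η;
  dual_injr : forall x y, (forall ξ, dual_fun ξ x = dual_fun ξ y) -> x = y
}.

(* Group homomorphisms from T to the group of units K^*. *)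
Record unitHom (T : groupType) (K : pzRingType) := UnitHom {
  unit_fun :> T -> K;
  unit_fun_unit : forall c, exists2 d, unit_fun c * d = 1 & d * unit_fun c = 1;
  unit_funM : forall c d, unit_fun (c * d)%g = unit_fun c * unit_fun d
}.

Record heis (Γ G : zmodType) (T : abGroupType) (β : duality Γ G T) :=
  Heis { hT : T; hG : G; hΓ : Γ }.

Section HeisenbergGroup.
Variables (Γ G : zmodType) (T : abGroupType) (β : duality Γ G T).
Local Notation H := (heis β).
Implicit Types g h k : H.

Definition heis_code g := (hT g, hG g, hΓ g).
Definition heis_decode (p : T * G * Γ) : H := Heis β p.1.1 p.1.2 p.2.
Fact heis_codeK : cancel heis_code heis_decode. Proof. by case. Qed.
HB.instance Definition _ := Choice.copy H (can_type heis_codeK).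

Definition heis_one : H := Heis β 1%g 0 0.
Definition heis_mul g h : H :=
  Heis β (hT g * hT h * β (hΓ g) (hG h))%g (hG g + hG h) (hΓ g + hΓ h).
Definition heis_inv g : H :=
  Heis β ((hT g)^-1 * β (hΓ g) (hG g))%g (- hG g) (- hΓ g).

Lemma dual0l x : β 0 x = 1%g.
Proof. by apply: (@mulgI _ (β 0 x)); rewrite -dualDl addr0 mulg1. Qed.

Lemma dual0r ξ : β ξ 0 = 1%g.
Proof. by apply: (@mulgI _ (β ξ 0)); rewrite -dualDr addr0 mulg1. Qed.

Lemma dualNl ξ x : β (- ξ) x = (β ξ x)^-1%g.
Proof. by apply: (@mulgI _ (β ξ x)); rewrite -dualDl subrr dual0l mulgV. Qed.

Lemma dualNr ξ x : β ξ (- x) = (β ξ x)^-1%g.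
Proof. by apply: (@mulgI _ (β ξ x)); rewrite -dualDr subrr dual0r mulgV. Qed.

Fact heis_mulA : associative heis_mul.
Proof.
move=> [c x ξ] [d y η] [e z ζ]; rewrite /heis_mul /= dualDl dualDr !addrA.
congr Heis; rewrite -!mulgA; congr (_ * (_ * _))%g.
rewrite (cmulgC (β η z)) -!mulgA !mulgA; congr (_ * _ * _)%g; exact: cmulgC.
Qed.

Fact heis_mul1g : left_id heis_one heis_mul.
Proof. by case=> c x ξ; rewrite /heis_mul /= dual0l mul1g mulg1 !add0r. Qed.

Fact heis_mulg1 : right_id heis_one heis_mul.
Proof. by case=> c x ξ; rewrite /heis_mul /= dual0r !mulg1 !addr0. Qed.

Fact heis_mulVg : left_inverse heis_one heis_inv heis_mul.
Proof.
case=> c x ξ; rewrite /heis_mul /heis_inv /heis_one /= !addNr dualNl.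
congr Heis; rewrite [X in (X * _)%g]cmulgC !mulgA mulgV mul1g; exact: mulgV.
Qed.

Fact heis_mulgV : right_inverse heis_one heis_inv heis_mul.
Proof.
case=> c x ξ; rewrite /heis_mul /heis_inv /heis_one /= !subrr dualNr.
by congr Heis; rewrite !mulgA mulgV mul1g mulgV.
Qed.

HB.instance Definition _ := isGroup.Build H
  heis_mulA heis_mul1g heis_mulg1 heis_mulVg heis_mulgV.

End HeisenbergGroup.

Section HeisenbergAction.
Variables (K : comPzRingType) (Γ G : zmodType) (T : abGroupType).
Variables (β : duality Γ G T) (ε : unitHom T K).
Local Notation H := (heis β).

Definition heis_module (S : lmodType K) (act : H -> S -> S) : Prop :=
  [/\ forall g, linear (act g),
      forall s, act 1%g s = s,
      forall g h s, act (g * h)%g s = act g (act h s)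
    & forall c s, act (Heis β c 0 0) s = ε c *: s].

Definition heis_algebra (A : nuComAlgType K) (act : H -> A -> A) : Prop :=
  [/\ heis_module act,
      forall x a b, act (Heis β 1%g x 0) (a ∗ b) = act (Heis β 1%g x 0) a ∗ b
    & forall ξ a b, act (Heis β 1%g 0 ξ) (a ∗ b) =
        act (Heis β 1%g 0 ξ) a ∗ act (Heis β 1%g 0 ξ) b].

Definition heis_module_morphism (S U : lmodType K)
    (actS : H -> S -> S) (actU : H -> U -> U) (f : S -> U) : Prop :=
  linear f /\ forall g s, f (actS g s) = actU g (f s).

Definition heis_algebra_morphism (A B : nuComAlgType K)
    (actA : H -> A -> A) (actB : H -> B -> B) (f : A -> B) : Prop :=
  heis_module_morphism actA actB f /\ {morph f : a b / a ∗ b}.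

End HeisenbergAction.

HB.mixin Record Lmodule_isHeisModule (K : comPzRingType) (Γ G : zmodType)
    (T : abGroupType) (β : duality Γ G T) (ε : unitHom T K) S
    of GRing.Lmodule K S := {
  hact : heis β -> S -> S;
  hact_module : heis_module ε hact
}.
#[short(type="heisModType")]
HB.structure Definition HeisModule (K : comPzRingType) (Γ G : zmodType)
    (T : abGroupType) (β : duality Γ G T) (ε : unitHom T K) :=
  {S of GRing.Lmodule K S & Lmodule_isHeisModule K Γ G T β ε S}.

HB.mixin Record HeisModule_isHeisAlgebra (K : comPzRingType) (Γ G : zmodType)
    (T : abGroupType) (β : duality Γ G T) (ε : unitHom T K) A
    of HeisModule K β ε A & NuComAlg K A := {
  hact_algebra : heis_algebra ε (@hact _ _ _ _ _ _ A)
}.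
#[short(type="heisAlgType")]
HB.structure Definition HeisAlgebra (K : comPzRingType) (Γ G : zmodType)
    (T : abGroupType) (β : duality Γ G T) (ε : unitHom T K) :=
  {A of HeisModule K β ε A & NuComAlg K A
      & HeisModule_isHeisAlgebra K Γ G T β ε A}.

Arguments hact {K Γ G T β ε s} _ _.

Definition grpMod (K : comPzRingType) (Γ G : zmodType) (T : abGroupType)
  (β : duality Γ G T) (ε : unitHom T K) (S : heisModType β ε) : Type := S.

Section GroupAlgebraModule.
Variables (K : comPzRingType) (Γ G : zmodType) (T : abGroupType).
Variables (β : duality Γ G T) (ε : unitHom T K) (S : heisModType β ε).
Implicit Types (f g : groupAlg K G) (s t : grpMod S).

HB.instance Definition _ := GRing.Zmodule.on (grpMod S).

Definition grp_scale f s : grpMod S :=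
  lext (fun x => hact (Heis β 1%g x 0) (s : S) : S) f.

Lemma grp_scale_lin s f g a : grp_scale (a *: f + g) s =
  a *: (grp_scale f s : S) + grp_scale g s.
Proof. exact: linearP. Qed.

Lemma grp_scale_linr f a (s t : S) :
  grp_scale f (a *: s + t) = a *: (grp_scale f s : S) + grp_scale f t.
Proof.
have [actL _ _ _] := @hact_module _ _ _ _ _ _ S.
rewrite /grp_scale /lext scaler_sumr -big_split; apply: eq_bigr => x _ /=.
by rewrite actL scalerDr !scalerA mulrC.
Qed.

Lemma grp_scale_elt x s : grp_scale (gelt K x) s = hact (Heis β 1%g x 0) (s : S).
Proof. exact: lext_base. Qed.

Lemma grp_scale0 s : grp_scale 0 s = 0.
Proof. exact: linear0. Qed.

Lemma grp_scale0r f : grp_scale f 0 = 0.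
Proof.
by have := grp_scale_linr f (-1) 0 0; rewrite scaler0 addr0 scaleN1r addNr.
Qed.

Fact grp_scaleA f g s : grp_scale f (grp_scale g s) = grp_scale (f * g) s.
Proof.
have [_ _ actM _] := @hact_module _ _ _ _ _ _ S.
have mulD a p q r : gmul (a *: p + q : groupAlg K G) r = a *: gmul p r + gmul q r.
  exact: conv_linl.
have mulDr a p q r : gmul r (a *: p + q : groupAlg K G) = a *: gmul r p + gmul r q.
  exact: conv_linr.
rewrite -[f * g]/(gmul f g).
elim/freeMod_ind: f => [x||a f1 f2 IH1 IH2]; last 2 first.
- by rewrite /gmul conv0l !grp_scale0.
- by rewrite mulD !grp_scale_lin IH1 IH2.
elim/freeMod_ind: g => [y||a g1 g2 IH1 IH2]; last 2 first.
- by rewrite /gmul conv0r !grp_scale0 grp_scale0r.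
- by rewrite mulDr (grp_scale_lin s (gmul _ _)) grp_scale_lin grp_scale_linr IH1 IH2.
rewrite /gmul conv_base -!/(gelt K _) !grp_scale_elt -actM; congr hact.
by rewrite /monoid.mul /= /heis_mul /= dual0l !mulg1 addr0.
Qed.

Fact grp_scale1 : left_id 1 grp_scale.
Proof.
have [_ act1 _ _] := @hact_module _ _ _ _ _ _ S.
by move=> s; rewrite [LHS]grp_scale_elt; exact: act1.
Qed.

Fact grp_scaleDr : right_distributive grp_scale +%R.
Proof.
by move=> f s t; have := grp_scale_linr f 1 s t; rewrite !scale1r.
Qed.

Fact grp_scaleDl s : {morph grp_scale^~ s : f g / f + g}.
Proof. by move=> f g; have := grp_scale_lin s f g 1; rewrite !scale1r. Qed.

HB.instance Definition _ := GRing.Zmodule_isLmodule.Build (groupAlg K G) (grpMod S)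
  grp_scaleA grp_scale1 grp_scaleDr grp_scaleDl.

(* Sym_{KG}(S), viewed as a K-algebra along K -> KG. *)
Definition SymKG : Type := restr (@gconst K G) (Sym (grpMod S)).
HB.instance Definition _ := NuComAlg.on SymKG.

Definition SymKG_in (s : S) : SymKG := sym_in (s : grpMod S).

Definition SymKG_prod (s : S) (u : seq S) : SymKG :=
  sym_prod (s : grpMod S) (u : seq (grpMod S)).

Definition SymKG_scale (f : groupAlg K G) (a : SymKG) : SymKG :=
  f *: (a : Sym (grpMod S)).

End GroupAlgebraModule.

Arguments SymKG {K Γ G T β ε} S.

Section SymmetricAction.
Variables (K : comPzRingType) (Γ G : zmodType) (T : abGroupType).
Variables (β : duality Γ G T) (ε : unitHom T K) (S : heisModType β ε).

(* (x, ξ) • (s s_2 ... s_k) = x (s^ξ s_2^ξ ... s_k^ξ), x acting through KG. *)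
Definition sym_action_formula (act : heis β -> SymKG S -> SymKG S) : Prop :=
  forall (x : G) (ξ : Γ) (s : S) (u : seq S),
    act (Heis β 1%g x ξ) (SymKG_prod s u) =
    SymKG_scale (gelt K x)
      (SymKG_prod (hact (Heis β 1%g 0 ξ) s)
                  [seq hact (Heis β 1%g 0 ξ) t | t <- u]).

End SymmetricAction.

(* Main.v *)
Require Import Defs.
From HB Require Import structures.
From mathcomp Require Import all_boot all_order all_algebra.
From mathcomp Require Import boolp.

(* Sym_R(M) is free among nonunital commutative R-algebras. Since ξ commutes
   with x up to the scalar <ξ|x>, it acts on S semilinearly along the
   endomorphism x ↦ <ξ|x> x of KG, i.e. KG-linearly into the restriction of
   scalars of Sym_{KG}(S) along that endomorphism; freeness of Sym extends it
   multiplicatively. A Heisenberg algebra U is in particular a KG-algebra, and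
   φ is KG-linear, so freeness also gives the extension ψ. *)

Set Implicit Arguments.
Unset Strict Implicit.
Unset Printing Implicit Defensive.

Import GRing.Theory.
Local Open Scope ring_scope.

Lemma foldl_map (A B C : Type) (h : A -> B) (f : C -> B -> C) z s :
  foldl f z (map h s) = foldl (fun x t => f x (h t)) z s.
Proof. by elim: s z => //= t s IHs z. Qed.

(** * Universal property of the positive-degree symmetric algebra *)

Section SymUniversal.
Variables (R : comPzRingType) (M : lmodType R).

Lemma nmul_linr (A : nuComAlgType R) (a : A) : linear (nmul a).
Proof. by move=> k b c; rewrite ![a ∗ _]nmulC nmul_linl. Qed.

Lemma nmul0l (A : nuComAlgType R) (b : A) : 0 ∗ b = 0.
Proof.
(* Linearity at [-1], [0], [0] reads f(0) = -f(0) + f(0). The same device recurs below for maps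
   whose linearity is only a proposition. *)
by have := nmul_linl b (-1) 0 0; rewrite scaler0 addr0 scaleN1r addNr.
Qed.

Lemma sym_prodE (s : M) u : sym_prod s u = sym_pi (tens (s :: u)).
Proof.
elim/last_ind: u => [|u t IHu] //; rewrite /sym_prod foldl_rcons -/(sym_prod s u).
rewrite IHu -[LHS]/(sym_mul _ _) sym_pi_mul.
by rewrite (conv_tensl [::] s t u [::]) -cats1.
Qed.

Lemma sym_ind (P : Sym M -> Prop) :
    (forall s u, P (sym_prod s u)) -> P 0 ->
    (forall a x y, P x -> P y -> P (a *: x + y)) ->
  forall x, P x.
Proof.
move=> Pprod P0 PD; elim/sym_elim=> w.
elim/freeMod_ind: w => [[s u]||a v w IHv IHw].
- by have := Pprod s u; rewrite sym_prodE.
- by rewrite raddf0.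
- by rewrite linearP; apply: PD.
Qed.

Section Lift.
Variables (A : nuComAlgType R) (f : {linear M -> A}).

(** The initial factor [p] is kept as a parameter because A has no unit; linearity in one letter of
    a word then reduces to linearity in [p]. *)
Definition prod_from (p : A) (u : seq M) : A := foldl (fun q t => q ∗ f t) p u.

Definition word_prod (w : word M) : A := prod_from (f w.1) w.2.

Definition words_lift (w : freeMod R (word M)) : A := lext word_prod w.

Lemma prod_from_linear u : linear (prod_from^~ u).
Proof.
rewrite /prod_from => a p q.
by elim: u p q => [|t u IHu] p q //=; rewrite nmul_linl IHu.
Qed.

Lemma words_lift_tens s u : words_lift (tens (s :: u)) = prod_from (f s) u.
Proof. exact: lext_base. Qed.

Lemma words_lift_split t w s v : words_lift (tens ((t :: w) ++ s :: v)) =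
  prod_from (prod_from (f t) w ∗ f s) v.
Proof. by rewrite [LHS]words_lift_tens /prod_from foldl_cat. Qed.

Lemma words_lift_linear : linear words_lift.
Proof. by move=> a v w; rewrite /words_lift linearP. Qed.

HB.instance Definition _ := GRing.isLinear.Build R (freeMod R (word M)) A *:%R
  words_lift words_lift_linear.

Lemma words_lift_linear_at u v : linear (fun s => words_lift (tens (u ++ s :: v))).
Proof.
case: u => [|t u] a r s.
  by rewrite /= !words_lift_tens linearP prod_from_linear.
by rewrite !words_lift_split linearP nmul_linr prod_from_linear.
Qed.

(** The first two families of relations die by linearity in one letter, the third by commutativity
    and associativity of A. *)
Lemma words_lift_ideal w : w \in @sym_ideal R M -> words_lift w = 0.
Proof.
move=> /sym_idealP; elim=> {w} [w r||a v w _ v0 _ w0].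
- case: r => [u s t v|u a s v|u s t v]; rewrite linearB; apply/eqP;
    rewrite subr_eq0; apply/eqP.
  + rewrite linearD.
    by have := words_lift_linear_at u v 1 s t; rewrite !scale1r.
  + rewrite linearZ /=.
    have D := words_lift_linear_at u v; have := D (-1) 0 0.
    rewrite scaler0 addr0 scaleN1r addNr => L0.
    by have := D a s 0; rewrite addr0 L0 addr0.
  + case: u => [|r u]; rewrite /= !words_lift_tens /=.
      (* With an empty prefix the first swapped letter is the initial factor itself, so this case is
         separate. *)
      by rewrite /prod_from /= nmulC.
    by rewrite /prod_from !foldl_cat /= -!nmulA [f s ∗ _]nmulC.
- exact: linear0.
- by rewrite linearP /= v0 w0 scaler0 addr0.
Qed.

(** The choice of representative is harmless because [words_lift] vanishes on the ideal. *)
Definition sym_lift (x : Sym M) : A := words_lift (sym_repr x).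

Lemma sym_lift_pi w : sym_lift (sym_pi w) = words_lift w.
Proof.
apply/eqP; rewrite -subr_eq0 -linearB; apply/eqP/words_lift_ideal.
exact/sym_piP/sym_reprK.
Qed.

Lemma sym_lift_linear : linear sym_lift.
Proof.
move=> a x y; elim/sym_elim: x => v; elim/sym_elim: y => w.
by rewrite -linearP !sym_lift_pi linearP.
Qed.

HB.instance Definition _ := GRing.isLinear.Build R (Sym M) A *:%R
  sym_lift sym_lift_linear.

Lemma sym_lift_in s : sym_lift (sym_in s) = f s.
Proof. by rewrite sym_lift_pi words_lift_tens. Qed.

Lemma sym_lift_prod s u :
  sym_lift (sym_prod s u) = foldl (fun q t => q ∗ f t) (f s) u.
Proof. by rewrite sym_prodE sym_lift_pi words_lift_tens. Qed.

Lemma prod_from_mul p q u : prod_from (p ∗ q) u = p ∗ prod_from q u.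
Proof. by elim: u q => [|t u IHu] q //=; rewrite -nmulA IHu. Qed.

(** Both sides are bilinear in the representing words, so basis words suffice; there concatenation
    becomes multiplication by [prod_from_mul]. *)
Lemma sym_liftM : {morph sym_lift : x y / x ∗ y}.
Proof.
move=> x y; elim/sym_elim: x => v; elim/sym_elim: y => w.
rewrite -[sym_pi v ∗ _]/(sym_mul _ _) sym_pi_mul !sym_lift_pi.
pose Q v w :=
  words_lift (conv (@wcat R M) v w) = words_lift v ∗ words_lift w.
have Ql a v1 v2 w' : Q v1 w' -> Q v2 w' -> Q (a *: v1 + v2) w'.
  by move=> Q1 Q2; rewrite /Q conv_linl !words_lift_linear nmul_linl; congr (_ *: _ + _).
have Qr a v' w1 w2 : Q v' w1 -> Q v' w2 -> Q v' (a *: w1 + w2).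
  by move=> Q1 Q2; rewrite /Q conv_linr !words_lift_linear nmul_linr; congr (_ *: _ + _).
rewrite -/(Q v w).
elim/freeMod_ind: v => [[s u]||a v1 v2 IH1 IH2]; last exact: Ql.
- elim/freeMod_ind: w => [[t w]||a w1 w2 IH1 IH2]; last exact: Qr.
  + rewrite /Q conv_base -!/(tens (_ :: _)) !words_lift_tens.
    by rewrite -prod_from_mul /prod_from foldl_cat.
  + by rewrite /Q conv0r linear0 nmulC nmul0l.
- by rewrite /Q conv0l linear0 nmul0l.
Qed.

End Lift.

(** * The degree-one part of the symmetric algebra *)

Lemma sym_in_linear : linear (@sym_in R M).
Proof.
move=> a s t; rewrite /sym_in -linearP; apply/sym_piP.
rewrite -(subrKA (tens [:: a *: s] + tens [:: t])) rpredD //.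
  by apply/sym_idealP/linspan_gen; exact: (sym_relD [::]).
rewrite opprD addrACA subrr addr0.
by apply/sym_idealP/linspan_gen; exact: (sym_relZ [::]).
Qed.

Lemma sym_prodZ a (s : M) u : sym_prod (a *: s) u = a *: sym_prod s u.
Proof.
rewrite !sym_prodE -linearZ; apply/sym_piP.
by apply/sym_idealP/linspan_gen; exact: (sym_relZ [::]).
Qed.

Lemma sym_prod_rcons (s : M) u t :
  sym_prod s (rcons u t) = sym_prod s u ∗ sym_in t.
Proof. exact: foldl_rcons. Qed.

Definition word_degree1 (w : word M) : M := if w.2 is [::] then w.1 else 0.

(** The projection onto one-letter words, the linear extension of [word_degree1], kills the ideal
    and so yields a left inverse of [sym_in]. *)
Lemma sym_in_inj : injective (@sym_in R M).
Proof.
pose p : {linear freeMod R (word M) -> M} := lext word_degree1.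
have p1 s : p (tens [:: s]) = s by exact: lext_base.
have p2 s t u v : p (tens (u ++ s :: t :: v)) = 0.
  by case: u => [|r [|r' u]]; exact: lext_base.
have p3 s t u v : p (tens (t :: u ++ s :: v)) = 0.
  by case: u => [|r u]; exact: lext_base.
have p0 w : w \in @sym_ideal R M -> p w = 0.
  move=> /sym_idealP; elim=> {w} [w r||a v w _ v0 _ w0]; last 2 first.
  - exact: linear0.
  - by rewrite linearP v0 w0 scaler0 addr0.
  case: r => [u s t v|u a s v|u s t v]; rewrite linearB.
  - rewrite linearD; case: u => [|r u]; last by rewrite !p3 addr0 subr0.
    case: v => [|r v]; first by rewrite !p1 subrr.
    by rewrite !(p2 _ _ [::]) addr0 subr0.
  - rewrite linearZ /=; case: u => [|r u]; last by rewrite !p3 scaler0 subr0.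
    case: v => [|r v]; first by rewrite !p1 subrr.
    by rewrite !(p2 _ _ [::]) scaler0 subr0.
  - by rewrite !p2 subr0.
move=> s t /sym_piP/p0; rewrite linearB !p1 => /eqP.
by rewrite subr_eq0 => /eqP.
Qed.

End SymUniversal.

Section Heisenberg.

(** * Commutation in the Heisenberg group and in its modules *)

Variables (K : comPzRingType) (Γ G : zmodType) (T : abGroupType).
Variables (β : duality Γ G T) (ε : unitHom T K).
Local Notation KG := (groupAlg K G).
Local Notation H := (heis β).

(** By multiplicativity [ε 1] is idempotent, and an idempotent unit is 1. *)
Lemma unit_fun1 : ε 1%g = 1.
Proof.
have [d e1 _] := unit_fun_unit ε 1%g.
by rewrite -[LHS]mulr1 -[X in _ * X]e1 mulrA -unit_funM mulg1.
Qed.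

Lemma heis_mulE c x ξ d y η :
  (Heis β c x ξ * Heis β d y η)%g = Heis β (c * d * β ξ y)%g (x + y) (ξ + η).
Proof. by []. Qed.

Lemma heis_GΓ x ξ : Heis β 1%g x ξ = (Heis β 1%g x 0 * Heis β 1%g 0 ξ)%g.
Proof. by rewrite heis_mulE dual0r !mulg1 addr0 add0r. Qed.

Lemma heis_split c x ξ : Heis β c x ξ =
  (Heis β c 0 0 * (Heis β 1%g x 0 * Heis β 1%g 0 ξ))%g.
Proof. by rewrite -heis_GΓ heis_mulE dual0l !mulg1 !add0r. Qed.

Section HeisModuleTheory.
Variables (V : lmodType K) (act : H -> V -> V) (actV : heis_module ε act).

Lemma heis_module_split c x ξ v : act (Heis β c x ξ) v =
  ε c *: act (Heis β 1%g x 0) (act (Heis β 1%g 0 ξ) v).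
Proof. by case: actV => _ _ actM actT; rewrite heis_split !actM actT. Qed.

(** In the Heisenberg group ξ x = <ξ|x> x ξ: this scalar is what makes ξ act semilinearly over
    KG. *)
Lemma heis_module_swap x ξ v :
  act (Heis β 1%g 0 ξ) (act (Heis β 1%g x 0) v) =
  ε (β ξ x) *: act (Heis β 1%g x 0) (act (Heis β 1%g 0 ξ) v).
Proof.
case: (actV) => _ _ actM _; rewrite -actM heis_mulE add0r addr0 !mul1g.
exact: heis_module_split.
Qed.

Lemma heis_module_addΓ ξ η v :
  act (Heis β 1%g 0 ξ) (act (Heis β 1%g 0 η) v) = act (Heis β 1%g 0 (ξ + η)) v.
Proof.
by case: actV => _ _ actM _; rewrite -actM heis_mulE dual0r !mulg1 addr0.
Qed.

End HeisModuleTheory.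

(** * The group algebra and its twists by characters of G *)

Lemma gmulZl a (f g : KG) : (a *: f) * g = a *: (f * g).
Proof. exact: convZl. Qed.

Lemma gmulZr a (f g : KG) : f * (a *: g) = a *: (f * g).
Proof. exact: convZr. Qed.

Lemma gmul_elt (x y : G) : (gelt K x : KG) * gelt K y = gelt K (x + y).
Proof. exact: conv_base. Qed.

Lemma gconst_mul a (f : KG) : gconst G a * f = a *: f.
Proof. by rewrite gmulZl mul1r. Qed.

Section Twist.
Variable ξ : Γ.

Definition gtwist : KG -> KG := lext (fun x => ε (β ξ x) *: gelt K x).
HB.instance Definition _ := GRing.Linear.copy gtwist gtwist.

Lemma gtwist_elt x : gtwist (gelt K x) = ε (β ξ x) *: gelt K x.
Proof. exact: lext_base. Qed.

(** This keeps maps that are semilinear along [gtwist ξ] linear over K. *)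
Lemma gtwist_const a : gtwist (gconst G a) = gconst G a.
Proof. by rewrite linearZ /= gtwist_elt dual0r unit_fun1 scale1r. Qed.

(** By bilinearity group elements suffice, and there it says that x ↦ <ξ|x> is a character. *)
Fact gtwist_monoid_morphism : monoid_morphism gtwist.
Proof.
split; first by rewrite -(rmorph1 (@gconst K G)) gtwist_const.
pose Q f g := gtwist (f * g) = gtwist f * gtwist g.
have Ql a f1 f2 g : Q f1 g -> Q f2 g -> Q (a *: f1 + f2) g.
  rewrite /Q mulrDl gmulZl !linearP mulrDl gmulZl => Q1 Q2.
  exact: (f_equal2 (fun p q : KG => a *: p + q) Q1 Q2).
have Qr a f g1 g2 : Q f g1 -> Q f g2 -> Q f (a *: g1 + g2).
  rewrite /Q mulrDr gmulZr !linearP mulrDr gmulZr => Q1 Q2.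
  exact: (f_equal2 (fun p q : KG => a *: p + q) Q1 Q2).
move=> f g; rewrite -/(Q f g).
elim/freeMod_ind: f => [x||a f1 f2 IH1 IH2]; last exact: Ql.
- elim/freeMod_ind: g => [y||a g1 g2 IH1 IH2]; last exact: Qr.
  + rewrite /Q -!/(gelt K (_ : G)) gmul_elt !gtwist_elt gmulZl gmulZr gmul_elt.
    by rewrite scalerA dualDr unit_funM.
  + by rewrite /Q mulr0 !linear0 mulr0.
- by rewrite /Q mul0r !linear0 mul0r.
Qed.
HB.instance Definition _ :=
  GRing.isMonoidMorphism.Build KG KG gtwist gtwist_monoid_morphism.

End Twist.

(** * Heisenberg modules as modules over the group algebra *)

Section GroupModule.
Variable V : heisModType β ε.
Implicit Types (f g : KG) (v w : grpMod V).

Lemma hact_linear (h : H) : linear (hact h : V -> V).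
Proof. by case: (@hact_module _ _ _ _ _ _ V). Qed.
HB.instance Definition _ (h : H) :=
  GRing.isLinear.Build K V V *:%R (hact h) (hact_linear h).

Lemma gelt_scale x v : gelt K x *: v = hact (Heis β 1%g x 0) (v : V).
Proof. exact: grp_scale_elt. Qed.

Lemma gconst_scale a v : gconst G a *: v = a *: (v : V).
Proof.
have := grp_scale_lin v (gelt K 0) 0 a.
by rewrite addr0 grp_scale0 addr0 [grp_scale (gelt K 0) v]grp_scale1.
Qed.

Lemma gZ_scale a f v : (a *: f) *: v = a *: (f *: v : V).
Proof. by rewrite -gconst_mul -scalerA gconst_scale. Qed.

(** G spans KG over K, so K-linearity and G-equivariance give KG-linearity. On [W] the ring K acts
    through [gconst], so that [W] may be a restriction of scalars along a twist. *)
Lemma grp_linear_ind (W : lmodType KG) (h : V -> W) :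
    (forall a (v w : V), h (a *: v + w) = gconst G a *: h v + h w) ->
    (forall x v, h (hact (Heis β 1%g x 0) v) = gelt K x *: h v) ->
  linear (h : grpMod V -> W).
Proof.
move=> hL hx.
have hD (v w : V) : h (v + w) = h v + h w.
  by rewrite -[v in LHS]scale1r hL rmorph1 scale1r.
have h0 : h 0 = 0.
  by have := hL (-1) 0 0; rewrite scaler0 addr0 rmorphN1 scaleN1r addNr.
have hZ a (v : V) : h (a *: v) = gconst G a *: h v.
  by rewrite -[a *: v]addr0 hL h0 addr0.
move=> f v w; rewrite [LHS]hD; congr (_ + _).
elim/freeMod_ind: f => [x||a f g IHf IHg].
- by rewrite -/(gelt K (_ : G)) gelt_scale hx.
- by rewrite !scale0r h0.
- by rewrite !scalerDl gZ_scale hL IHf IHg scalerA gconst_mul.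
Qed.

(** * The semilinear action of Γ on the symmetric algebra *)

Section Twisted.
Variable ξ : Γ.

Definition sym_twist_in (v : grpMod V) : restr (gtwist ξ) (Sym (grpMod V)) :=
  sym_in (hact (Heis β 1%g 0 ξ) (v : V) : grpMod V).

(** In the restricted module x acts as [gtwist ξ] of x, i.e. as <ξ|x> x, which is the factor that
    appears when ξ is moved past x. *)
Lemma sym_twist_in_linear : linear sym_twist_in.
Proof.
have inL := sym_in_linear (M := grpMod V).
have inZ a (v : grpMod V) : sym_in (a *: v) = a *: sym_in v.
  exact: sym_prodZ a v [::].
have actP := @hact_module _ _ _ _ _ _ V.
apply: (grp_linear_ind (h := sym_twist_in)) => [a v w|x v]; rewrite /sym_twist_in.
  rewrite linearP /= -gconst_scale [LHS]inL.
  by rewrite -[gconst G a in LHS](gtwist_const ξ).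
rewrite (heis_module_swap actP) -gconst_scale -gelt_scale scalerA gconst_mul.
by rewrite -gtwist_elt [LHS]inZ.
Qed.

HB.instance Definition _ := GRing.isLinear.Build KG (grpMod V)
  (restr (gtwist ξ) (Sym (grpMod V))) *:%R sym_twist_in sym_twist_in_linear.

Definition sym_twist : Sym (grpMod V) -> Sym (grpMod V) :=
  sym_lift sym_twist_in.

Lemma sym_twist_linear f x y :
  sym_twist (f *: x + y) = gtwist ξ f *: sym_twist x + sym_twist y.
Proof. exact (sym_lift_linear sym_twist_in f x y). Qed.

Lemma sym_twist_zero : sym_twist 0 = 0.
Proof.
have := sym_twist_linear (-1) 0 0.
by rewrite scaler0 addr0 rmorphN1 scaleN1r addNr.
Qed.

Lemma sym_twistZ f x : sym_twist (f *: x) = gtwist ξ f *: sym_twist x.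
Proof. by rewrite -[f *: x]addr0 sym_twist_linear sym_twist_zero addr0. Qed.

Lemma sym_twistM : {morph sym_twist : x y / x ∗ y}.
Proof. exact (sym_liftM sym_twist_in). Qed.

Lemma sym_twist_prod (s : V) (u : seq V) :
  sym_twist (sym_prod (s : grpMod V) (u : seq (grpMod V))) =
  sym_prod (hact (Heis β 1%g 0 ξ) s : grpMod V)
    ([seq hact (Heis β 1%g 0 ξ) t | t <- u] : seq (grpMod V)).
Proof.
exact (etrans (sym_lift_prod sym_twist_in s u)
  (esym (foldl_map (hact (Heis β 1%g 0 ξ)) (fun q t => q ∗ sym_in (t : grpMod V)) _ u))).
Qed.

End Twisted.

Lemma gtwist0 f : gtwist 0 f = f.
Proof.
elim/freeMod_ind: f => [x||a f g IHf IHg].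
- by rewrite -/(gelt K (_ : G)) gtwist_elt dual0l unit_fun1 scale1r.
- exact: linear0.
- by rewrite linearP; exact: (f_equal2 (fun p q : KG => a *: p + q) IHf IHg).
Qed.

Lemma gtwistD ξ η f : gtwist ξ (gtwist η f) = gtwist (ξ + η) f.
Proof.
elim/freeMod_ind: f => [x||a f g IHf IHg].
- rewrite -/(gelt K (_ : G)) !gtwist_elt linearZ /= gtwist_elt scalerA -unit_funM.
  by rewrite dualDl cmulgC.
- by rewrite !linear0.
- by rewrite !linearP; exact: (f_equal2 (fun p q : KG => a *: p + q) IHf IHg).
Qed.

Lemma sym_twist0 x : sym_twist 0 x = x.
Proof.
have [_ act1 _ _] := @hact_module _ _ _ _ _ _ V.
elim/sym_ind: x => [s u||f x y IHx IHy].
- rewrite sym_twist_prod; congr sym_prod; first exact: act1.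
  by rewrite (eq_map (g := id)) ?map_id // => t; exact: act1.
- exact: sym_twist_zero.
- rewrite sym_twist_linear gtwist0.
  exact: (f_equal2 (fun p q : Sym (grpMod V) => f *: p + q) IHx IHy).
Qed.

(** On products this is the action of Γ on each factor; [gtwistD] matches the KG-coefficients under
    linear combinations. *)
Lemma sym_twistD ξ η x : sym_twist ξ (sym_twist η x) = sym_twist (ξ + η) x.
Proof.
have addΓ := heis_module_addΓ (@hact_module _ _ _ _ _ _ V).
elim/sym_ind: x => [s u||f x y IHx IHy].
- rewrite !sym_twist_prod -map_comp; congr sym_prod; first exact: addΓ.
  by apply: eq_map => t; exact: addΓ.
- by rewrite !sym_twist_zero.
- rewrite !sym_twist_linear gtwistD.
  exact: (f_equal2 (fun p q : Sym (grpMod V) => _ *: p + q) IHx IHy).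
Qed.

(** * The Heisenberg action on the symmetric algebra *)

Definition heis_coef (h : H) : KG := ε (hT h) *: gelt K (hG h).

Lemma heis_coefΓ ξ : heis_coef (Heis β 1%g 0 ξ) = 1.
Proof. by rewrite /heis_coef unit_fun1 scale1r. Qed.

(** A crossed homomorphism law: the twist supplies the factor <ξ|x'> of the product in the
    Heisenberg group. *)
Lemma heis_coefM (g h : H) :
  heis_coef (g * h)%g = heis_coef g * gtwist (hΓ g) (heis_coef h).
Proof.
rewrite /heis_coef linearZ /= gtwist_elt gmulZl !gmulZr gmul_elt !scalerA.
by rewrite !unit_funM.
Qed.

Lemma heis_coef_scale (h : H) v :
  heis_coef h *: (hact (Heis β 1%g 0 (hΓ h)) (v : V) : grpMod V) = hact h (v : V).
Proof.
rewrite gZ_scale gelt_scale -(heis_module_split (@hact_module _ _ _ _ _ _ V)).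
by case: h.
Qed.

Definition sym_act (h : H) (p : SymKG V) : SymKG V :=
  heis_coef h *: (sym_twist (hΓ h) p : Sym (grpMod V)).

Lemma SymKG_scaleE a (p : SymKG V) :
  a *: p = gconst G a *: (p : Sym (grpMod V)).
Proof. by []. Qed.

Lemma sym_act_module : heis_module ε sym_act.
Proof.
split=> [h a p q|p|g h p|c p].
- rewrite /sym_act !SymKG_scaleE [sym_twist _ _]sym_twist_linear gtwist_const.
  by rewrite scalerDr !scalerA mulrC.
- by rewrite /sym_act heis_coefΓ scale1r sym_twist0.
(* Pulling the coefficient of [h] out of the semilinear twist by [g] twists it, as the crossed
   homomorphism law requires. *)
- by rewrite /sym_act sym_twistZ scalerA -heis_coefM sym_twistD.
- by rewrite /sym_act sym_twist0.
Qed.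

Lemma SymKG_mulZl f (p q : Sym (grpMod V)) : (f *: p) ∗ q = f *: (p ∗ q).
Proof. by rewrite -[f *: p]addr0 nmul_linl nmul0l addr0. Qed.

(** G acts by scalars of KG, which pass to one factor of a product, and Γ acts by the multiplicative
    maps [sym_twist]. *)
Lemma sym_act_algebra : heis_algebra ε sym_act.
Proof.
split=> [|x p q|ξ p q]; first exact: sym_act_module.
- by rewrite /sym_act !sym_twist0; exact (esym (SymKG_mulZl _ _ _)).
- have actΓ r : sym_act (Heis β 1%g 0 ξ) r = sym_twist ξ r.
    by rewrite /sym_act heis_coefΓ scale1r.
  exact (etrans (actΓ _) (etrans (sym_twistM ξ p q)
    (f_equal2 _ (esym (actΓ p)) (esym (actΓ q))))).
Qed.

Lemma sym_act_formula : sym_action_formula sym_act.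
Proof.
move=> x ξ s u; rewrite /sym_act /heis_coef /= unit_fun1 scale1r.
exact (f_equal (fun p => gelt K x *: p) (sym_twist_prod ξ s u)).
Qed.

(** * Induction over K and uniqueness of the action *)

Lemma SymKG_ind (P : SymKG V -> Prop) :
    (forall s u, P (SymKG_prod s u)) -> P 0 ->
    (forall a p q, P p -> P q -> P (a *: p + q)) ->
  forall p, P p.
Proof.
move=> Pprod P0 PL p.
(* Products span over KG; the claim is strengthened to all KG-multiples, since a group element can
   be absorbed into the first factor and only K-combinations remain. *)
suff PZ f : P (f *: (p : Sym (grpMod V))) by rewrite -[p](@scale1r KG); exact: PZ.
elim/sym_ind: p f => [s u||g p q IHp IHq] f.
- elim/freeMod_ind: f => [x||a f g IHf IHg].
  + by rewrite -sym_prodZ; exact: Pprod.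
  + by rewrite scale0r.
  + by rewrite scalerDl -gconst_mul -scalerA; exact: PL.
- by rewrite scaler0.
- rewrite scalerDr scalerA -[f * g *: p](@scale1r KG) -(rmorph1 (@gconst K G)).
  exact: PL.
Qed.

Lemma SymKG_alg_ind (P : SymKG V -> Prop) :
    (forall s, P (SymKG_in s)) -> (forall p s, P p -> P (p ∗ SymKG_in s)) -> P 0 ->
    (forall a p q, P p -> P q -> P (a *: p + q)) ->
  forall p, P p.
Proof.
move=> Pin PM P0 PL; apply: SymKG_ind => // s u.
elim/last_ind: u => [|u t IHu]; first exact: Pin.
by rewrite /SymKG_prod sym_prod_rcons; exact: PM.
Qed.

Lemma sym_act_unique act :
  heis_algebra ε act -> sym_action_formula act -> act = sym_act.
Proof.
move=> [actP _ _] actF; apply: funext => h; apply: funext => p.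
have [actL _ _ _] := actP; have [actL' _ _ _] := sym_act_module.
elim/SymKG_ind: p => [s u||a p q IHp IHq].
- case: h => c x ξ.
  have [_ _ actM actT] := actP; have [_ _ actM' actT'] := sym_act_module.
  (* Splitting off c alone leaves (x,ξ), whose action on products is prescribed by the formula,
     while c acts by [ε c]. *)
  rewrite (heis_split c x ξ) -heis_GΓ actM actM' actT actT'.
  exact (f_equal _ (etrans (actF x ξ s u) (esym (sym_act_formula x ξ s u)))).
- have := actL h (-1) 0 0; have := actL' h (-1) 0 0.
  by rewrite !scaler0 !addr0 !scaleN1r !addNr => -> ->.
- rewrite actL actL'.
  exact (f_equal2 (fun v w : SymKG V => a *: v + w) IHp IHq).
Qed.

(** In degree one the coefficient moves into the only factor, where [heis_coef_scale] recovers the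
    action on S. *)
Lemma SymKG_in_morphism : heis_module_morphism hact sym_act (@SymKG_in _ _ _ _ _ _ V).
Proof.
split=> [a s t|h s].
- by rewrite /SymKG_in -gconst_scale; exact: sym_in_linear.
- rewrite /SymKG_in -heis_coef_scale; apply: etrans (sym_prodZ _ _ [::]) _.
  exact (f_equal _ (esym (sym_twist_prod (hΓ h) s [::]))).
Qed.

End GroupModule.

(** * Extension of Heisenberg morphisms to the symmetric algebra *)

Section Extension.
Variables (S : heisModType β ε) (U : heisAlgType β ε).

(** The axiom x•(ab) = (x•a)b is the G-equivariance that makes U a KG-algebra. *)
Fact grp_mul_linl (b : grpMod U) : linear ((@nmul K U)^~ b : grpMod U -> grpMod U).
Proof.
have [_ actG _] := @hact_algebra _ _ _ _ _ _ U.
apply: (grp_linear_ind (W := grpMod U) (h := (@nmul K U)^~ b)) => [a v w|x v].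
- by rewrite gconst_scale; exact: nmul_linl.
- by rewrite gelt_scale actG.
Qed.

HB.instance Definition _ := Lmodule_isNuComAlg.Build KG (grpMod U)
  (@nmulA K U) (@nmulC K U) grp_mul_linl.

Variables (φ : S -> U) (φP : heis_module_morphism hact hact φ).

Definition grp_morphism (s : grpMod S) : grpMod U := φ s.

Fact grp_morphism_linear : linear grp_morphism.
Proof.
have [φL φact] := φP.
apply: (grp_linear_ind (h := grp_morphism)) => [a v w|x v].
- by rewrite gconst_scale; exact: φL.
- by rewrite gelt_scale; exact: φact.
Qed.

HB.instance Definition _ := GRing.isLinear.Build KG (grpMod S) (grpMod U) *:%R
  grp_morphism grp_morphism_linear.

Definition SymKG_lift (p : SymKG S) : U :=
  sym_lift grp_morphism (p : Sym (grpMod S)).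

Lemma SymKG_lift_in s : SymKG_lift (SymKG_in s) = φ s.
Proof. exact (sym_lift_in grp_morphism s). Qed.

Lemma SymKG_liftM : {morph SymKG_lift : p q / p ∗ q}.
Proof. exact (sym_liftM grp_morphism). Qed.

Lemma SymKG_lift_linear_grp f (p q : Sym (grpMod S)) :
  SymKG_lift (f *: p + q) = f *: (SymKG_lift p : grpMod U) + SymKG_lift q.
Proof. exact (sym_lift_linear grp_morphism f p q). Qed.

Lemma SymKG_lift_linear : linear SymKG_lift.
Proof.
move=> a p q; apply: etrans (SymKG_lift_linear_grp _ _ _) _.
by rewrite gconst_scale.
Qed.

Lemma SymKG_lift0 : SymKG_lift 0 = 0.
Proof.
have := SymKG_lift_linear (-1) 0 0.
by rewrite scaler0 addr0 scaleN1r addNr.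
Qed.

(** Both sides are K-linear and multiplicative in [p], the right one because ξ acts multiplicatively
    on U, and on S they agree by equivariance of [φ]. *)
Lemma SymKG_lift_twist ξ p :
  SymKG_lift (sym_twist ξ p) = hact (Heis β 1%g 0 ξ) (SymKG_lift p).
Proof.
have [actP _ actΓ] := @hact_algebra _ _ _ _ _ _ U; have [actL _ _ _] := actP.
have twist_in s : SymKG_lift (sym_twist ξ (SymKG_in s)) =
    hact (Heis β 1%g 0 ξ) (SymKG_lift (SymKG_in s)).
  rewrite SymKG_lift_in -(proj2 φP); apply: etrans (SymKG_lift_in _).
  exact (f_equal SymKG_lift (sym_twist_prod ξ s [::])).
elim/SymKG_alg_ind: p => [s|p s IHp||a p q IHp IHq]; first exact: twist_in.
- apply: etrans (f_equal SymKG_lift (sym_twistM ξ p (SymKG_in s))) _.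
  apply: etrans (SymKG_liftM _ _) _.
  apply: etrans (f_equal2 (@nmul K U) IHp (twist_in s)) _.
  apply: etrans (esym (actΓ _ _ _)) _.
  exact (f_equal (hact _) (esym (SymKG_liftM _ _))).
- apply: etrans (f_equal SymKG_lift (sym_twist_zero S ξ)) _.
  have := actL (Heis β 1%g 0 ξ) (-1) 0 0; rewrite scaler0 addr0 scaleN1r addNr.
  by rewrite SymKG_lift0 => ->.
- apply: etrans (f_equal SymKG_lift (sym_twist_linear ξ _ p q)) _.
  rewrite SymKG_lift_linear actL gtwist_const; apply: etrans (SymKG_lift_linear _ _ _) _.
  exact (f_equal2 (fun v w : U => a *: v + w) IHp IHq).
Qed.

Lemma SymKG_lift_act h p : SymKG_lift (sym_act h p) = hact h (SymKG_lift p).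
Proof.
have LZ f q : SymKG_lift (f *: (q : Sym (grpMod S))) =
    f *: (SymKG_lift q : grpMod U).
  by rewrite -[f *: q]addr0 SymKG_lift_linear_grp SymKG_lift0 addr0.
rewrite -heis_coef_scale; apply: etrans (LZ _ _) _.
exact (f_equal (fun v : grpMod U => _ *: v) (SymKG_lift_twist _ _)).
Qed.

Lemma SymKG_lift_morphism : heis_algebra_morphism (@sym_act S) hact SymKG_lift.
Proof.
by split; [split; [exact: SymKG_lift_linear|exact: SymKG_lift_act]|exact: SymKG_liftM].
Qed.

(** By [SymKG_alg_ind] the image of S generates the K-algebra, so agreement on S propagates. *)
Lemma SymKG_lift_unique (ψ : SymKG S -> U) :
    linear ψ -> {morph ψ : p q / p ∗ q} -> (forall s, ψ (SymKG_in s) = φ s) ->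
  SymKG_lift = ψ.
Proof.
move=> ψL ψM ψin; apply: funext; elim/SymKG_alg_ind => [s|p s IHp||a p q IHp IHq].
- by rewrite SymKG_lift_in.
- apply: etrans (SymKG_liftM _ _) (esym (etrans (ψM _ _) _)).
  exact (f_equal2 (@nmul K U) (esym IHp) (etrans (ψin s) (esym (SymKG_lift_in s)))).
- have := ψL (-1) 0 0; rewrite scaler0 addr0 scaleN1r addNr => ->.
  exact: SymKG_lift0.
- apply: etrans (SymKG_lift_linear _ _ _) (esym (etrans (ψL _ _ _) _)).
  exact (f_equal2 (fun v w : U => a *: v + w) (esym IHp) (esym IHq)).
Qed.

End Extension.

End Heisenberg.

Theorem proposition24 (K : comPzRingType) (Γ G : zmodType) (T : abGroupType)
    (β : duality Γ G T) (ε : unitHom T K) (S : heisModType β ε) :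
  injective (@SymKG_in K Γ G T β ε S) /\
  exists act : heis β -> SymKG S -> SymKG S,
    [/\ unique (fun a => heis_algebra ε a /\ sym_action_formula a) act,
        heis_module_morphism hact act (@SymKG_in K Γ G T β ε S)
      & forall (U : heisAlgType β ε) (φ : S -> U),
          heis_module_morphism hact hact φ ->
          exists! ψ : SymKG S -> U,
            heis_algebra_morphism act hact ψ /\
            forall s : S, ψ (SymKG_in s) = φ s].
Proof.
split; first exact (@sym_in_inj _ (grpMod S)).
exists (@sym_act _ _ _ _ _ _ S); split.
- split; first by split; [exact: sym_act_algebra|exact: sym_act_formula].
  by move=> act [actP actF]; rewrite (sym_act_unique actP actF).
- exact: SymKG_in_morphism.
- move=> U φ φP; exists (SymKG_lift φP); split.
    by split; [exact: SymKG_lift_morphism|exact: SymKG_lift_in].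
  by move=> ψ [[[ψL _] ψM] ψin]; exact: SymKG_lift_unique.
Qed.
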